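(* Let $s\ge 2$ and $x_1,\dots,x_s\ge 2$ be integers and let $\eta_1,\eta_2\in\mathbb{Z}^+$. Put $X=\prod_{i=1}^s x_i$, $K=\sum_{i=1}^s x_i$, $N=\eta_1X$ and $Q=\eta_2X$, and consider the cascaded coded distributed computing network with $K$ nodes, $N$ files and $Q$ output functions with the combinatorial file and function assignment with parameters $(s;x_1,\dots,x_s;\eta_1,\eta_2)$ defined in the context. Let $r_{\rm c}=s$, let $$L_{\rm c}(r_{\rm c},s)=\frac{1}{2X}\sum_{\gamma=1}^{s-1}\ \sum_{\substack{\mathcal{A}\subset\{1,\dots,s\}\\ |\mathcal{A}|=\gamma}}\ \prod_{i\in\mathcal{A}}(x_i-1)\;+\;\frac{s}{X(2s-1)}\prod_{i=1}^{s}(x_i-1),$$ and let $L_{\rm c}^*(r_{\rm c},s)$ be the optimal (infimum) communication load over all achievable Shuffle schemes for this file and function assignment. Then $$1\le\frac{L_{\rm c}(r_{\rm c},s)}{L_{\rm c}^*(r_{\rm c},s)}\le 4.$$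
   Context: **Network model.** There are $K$ nodes $\{1,\dots,K\}$, $N$ input files $w_1,\dots,w_N$ of equal size, and $Q$ output functions $\phi_1,\dots,\phi_Q$, each of which depends on all $N$ files. Each output $u_i=\phi_i(w_1,\dots,w_N)$ decomposes as $u_i=h_i(g_{i,1}(w_1),\dots,g_{i,N}(w_N))$ with Map functions $g_{i,j}$ and Reduce function $h_i$. The intermediate values $v_{i,j}=g_{i,j}(w_j)$, $1\le i\le Q$, $1\le j\le N$, are $T$ bits each and are treated as arbitrary elements of $\{0,1\}^T$. Node $k$ stores a set of files $\mathcal{M}_k\subseteq\{w_1,\dots,w_N\}$ and is assigned a set of functions $\mathcal{W}_k\subseteq\{1,\dots,Q\}$. **Map phase.** Node $k$ computes all $v_{i,j}$ with $w_j\in\mathcal{M}_k$ and $i\in\{1,\dots,Q\}$. The computation load is the total number of intermediate values computed, summed over all nodes, divided by $QN$; for the assignment below it equals $s$. **Shuffle phase.** Over an error-free shared link, each node $k$ multicasts to all other nodes a message of some fixed length in bits that is a function of the intermediate values it computed in the Map phase. **Reduce phase.** From the multicast messages and its own computed intermediate values, each node $k$ must recover all $v_{i,j}$ with $i\in\mathcal{W}_k$ and $j\in\{1,\dots,N\}$, for every possible realization of the intermediate values. **Communication load.** The communication load $L$ of a Shuffle scheme is the total number of bits multicast in the Shuffle phase divided by $QNT$. A Shuffle scheme is achievable if the Reduce phase succeeds. The optimal load $L_{\rm c}^*(r_{\rm c},s)$ is the infimum of the communication load over all $T\in\mathbb{Z}^+$ and all achievable Shuffle schemes, with the file and function assignment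 fixed as below. **Combinatorial file and function assignment with parameters $(s;x_1,\dots,x_s;\eta_1,\eta_2)$.** The $K=\sum_i x_i$ nodes are partitioned into disjoint sets $\mathcal{K}_1,\dots,\mathcal{K}_s$ with $|\mathcal{K}_i|=x_i$. Let $\mathcal{T}_1,\dots,\mathcal{T}_X$, $X=\prod_i x_i$, be all the node sets $\mathcal{T}\subseteq\{1,\dots,K\}$ with $|\mathcal{T}\cap\mathcal{K}_i|=1$ for all $i\in\{1,\dots,s\}$. The $N=\eta_1X$ files are partitioned into disjoint sets $\mathcal{B}_1,\dots,\mathcal{B}_X$ of size $\eta_1$ each, and the $Q=\eta_2X$ output functions into disjoint sets $\mathcal{D}_1,\dots,\mathcal{D}_X$ of size $\eta_2$ each. Every node in $\mathcal{T}_i$ stores the files of $\mathcal{B}_i$ and is assigned the functions of $\mathcal{D}_i$; that is, $\mathcal{M}_k=\bigcup_{i:\,k\in\mathcal{T}_i}\mathcal{B}_i$ and $\mathcal{W}_k=\bigcup_{i:\,k\in\mathcal{T}_i}\mathcal{D}_i$. *)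

(* Defs.v *)
From HB Require Import structures.
From mathcomp Require Import all_boot all_order all_algebra.
From mathcomp Require Import classical_sets reals.

Set Implicit Arguments.
Unset Strict Implicit.
Unset Printing Implicit Defensive.

Import Order.TTheory GRing.Theory Num.Theory.
Local Open Scope ring_scope.

(* A realization of the intermediate values: [v (i, j)] is the value of output
   function i on file j. The Map and Reduce functions themselves do not appear,
   since the intermediate values are arbitrary elements of {0,1}^T. *)
Definition realization (Q N T : nat) := {ffun 'I_Q * 'I_N -> T.-tuple bool}.

(* What a node computes in the Map phase; [None] marks a value it does not
   compute. *)
Definition view (Q N T : nat) :=
  {ffun 'I_Q * 'I_N -> option (T.-tuple bool)}.

Definition map_phase (Q N T : nat) (F : {set 'I_N}) (v : realization Q N T) :
    view Q N T :=
  [ffun p => if p.2 \in F then Some (v p) else None].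

(* The message lengths are fixed: they do not depend on the realization. *)
Record shuffle_scheme (K Q N T : nat) := ShuffleScheme {
  msg_len : 'I_K -> nat;
  encode : forall k : 'I_K, view Q N T -> (msg_len k).-tuple bool }.

Definition messages (K Q N T : nat) (S : shuffle_scheme K Q N T) :=
  forall k : 'I_K, (msg_len S k).-tuple bool.

Definition shuffle (K Q N T : nat) (M : 'I_K -> {set 'I_N})
    (S : shuffle_scheme K Q N T) (v : realization Q N T) : messages S :=
  fun k => encode S k (map_phase (M k) v).

(* Node k may ignore its own message in [decode k]; having it as an argument
   gives nothing more, as it is a function of the node's own view. *)
Definition achievable (K Q N T : nat) (M : 'I_K -> {set 'I_N})
    (W : 'I_K -> {set 'I_Q}) (S : shuffle_scheme K Q N T) : Prop :=
  exists decode : 'I_K -> messages S -> view Q N T -> realization Q N T,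
    forall (v : realization Q N T) (k : 'I_K) (i : 'I_Q) (j : 'I_N),
      i \in W k ->
      decode k (shuffle M S v) (map_phase (M k) v) (i, j) = v (i, j).

Definition load (R : realType) (K Q N T : nat) (S : shuffle_scheme K Q N T) : R :=
  (\sum_(k < K) msg_len S k)%N%:R / (Q * N * T)%N%:R.

Definition optimal_load (R : realType) (K Q N : nat) (M : 'I_K -> {set 'I_N})
    (W : 'I_K -> {set 'I_Q}) : R :=
  inf [set L : R | exists T : nat, (0 < T)%N /\
        exists S : shuffle_scheme K Q N T,
          achievable M W S /\ L = load R S]%classic.

Definition is_partition_family (I T : finType) (P : I -> {set T}) : Prop :=
  (forall i j : I, i != j -> [disjoint P i & P j]) /\
  \bigcup_(i : I) P i = [set: T].

Record combinatorial_assignment (s : nat) (x : 'I_s -> nat) (eta1 eta2 : nat)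
    (K X N Q : nat) (Kp : 'I_s -> {set 'I_K}) (Tr : 'I_X -> {set 'I_K})
    (B : 'I_X -> {set 'I_N}) (D : 'I_X -> {set 'I_Q})
    (M : 'I_K -> {set 'I_N}) (W : 'I_K -> {set 'I_Q}) : Prop :=
  CombinatorialAssignment {
  ca_nodes : is_partition_family Kp;
  ca_nodes_card : forall i : 'I_s, #|Kp i| = x i;
  (* [Tr] enumerates without repetition all transversals of [Kp]. *)
  ca_trans_inj : injective Tr;
  ca_trans : forall U : {set 'I_K},
    (exists l : 'I_X, Tr l = U) <-> (forall i : 'I_s, #|U :&: Kp i| = 1%N);
  ca_files : is_partition_family B;
  ca_files_card : forall l : 'I_X, #|B l| = eta1;
  ca_funs : is_partition_family D;
  ca_funs_card : forall l : 'I_X, #|D l| = eta2;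
  ca_M : forall k : 'I_K, M k = \bigcup_(l < X | k \in Tr l) B l;
  ca_W : forall k : 'I_K, W k = \bigcup_(l < X | k \in Tr l) D l }.

Definition Lc (R : realType) (s : nat) (x : 'I_s -> nat) : R :=
  let X : R := (\prod_(i < s) x i)%N%:R in
  1 / (2 * X) *
    (\sum_(1 <= g < s) \sum_(A : {set 'I_s} | #|A| == g)
       \prod_(i in A) ((x i)%:R - 1))
  + s%:R / (X * (2 * s%:R - 1)) * \prod_(i < s) ((x i)%:R - 1).

(* Main.v *)
(* Write a, b for transversals and V_ab for the values of the functions of D_a
   on the files of B_b: known to the nodes of b, wanted by those of a.

   Upper bound, attained with T = 2s - 1.  If a <> b share a node, it sends
   V_ab + V_ba.  If a and b are disjoint, V_ab is split into bits
   alpha_1, ..., alpha_s with zero sum and free bits beta_1, ..., beta_s, and for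
   each i the node b_i sends alpha_i(V_ab) + beta_i(V_a'b'), where a', b' arise
   from b, a by exchanging the i-th coordinates.  For j <> i the node a_i lies in
   b' at j, so it learns alpha_j(V_ab) and, from the message of (a', b') at j,
   beta_j(V_ab).  The zero sum then gives alpha_i of every disjoint pair wanted
   by a_i, in particular alpha_i(V_a'b'), which unmasks beta_i(V_ab).

   Lower bound: the cut-set bound for half of the nodes of one class gives
   load >= 1/6, while Lc <= 2/3. *)
Require Import Defs.
From HB Require Import structures.
From mathcomp Require Import all_boot all_order all_algebra.
From mathcomp Require Import classical_sets boolp reals.
From mathcomp Require Import zify ring lra.

Set Implicit Arguments.
Unset Strict Implicit.
Unset Printing Implicit Defensive.

Import Order.TTheory GRing.Theory Num.Theory.
Local Open Scope ring_scope.

(** * Shuffle schemes for arbitrary assignments: a converse bound and a construction principle *)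

(** When all values outside the block [E] (wanted in [P], computed by no node of [P]) are frozen,
    every node of [P] has a constant view. The messages alone then determine the block, so there are
    at least as many message tuples as block contents. *)
Lemma cut_set_bound (K Q N T : nat) (M : 'I_K -> {set 'I_N})
    (W : 'I_K -> {set 'I_Q}) (S : shuffle_scheme K Q N T) (P : {set 'I_K}) :
  achievable M W S ->
  (#|\bigcup_(k in P) W k| * #|~: \bigcup_(k in P) M k| * T
     <= \sum_(k < K) msg_len S k)%N.
Proof.
move=> [decode decodeP].
set E := finset.setX (\bigcup_(k in P) W k) (~: \bigcup_(k in P) M k).
pose z : T.-tuple bool := [tuple of nseq T false].
(* [F] holds the realizations equal to the arbitrary constant [z] off [E]; there are
   [2 ^ (T * #|E|)] of them. *)
pose F := [pred v : realization Q N T | v \in pffun_on z (mem E) predT].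
pose f (v : realization Q N T) :
  {dffun forall k : 'I_K, (msg_len S k).-tuple bool} :=
  [ffun k => encode S k (map_phase (M k) v)].
have zE (v : realization Q N T) p : v \in F -> p \notin E -> v p = z.
  by case/pffun_onP => /supportP /(_ p) sv _; apply: sv.
have f_inj : {in F &, injective f}.
  move=> v v' vF v'F fE; apply/ffunP => -[i j].
  have [ijE|ijE] := boolP ((i, j) \in E); last by rewrite !zE.
  move: (ijE); rewrite finset.in_setX => /andP[/bigcupP[k kP iW]].
  rewrite inE => jM.
  have same_view : map_phase (M k) v = map_phase (M k) v'.
    apply/ffunP => -[i' j']; rewrite !ffunE /=; case: ifP => // j'M.
    have ijE' : (i', j') \notin E.
      rewrite finset.in_setX /= !inE negb_and negbK orbC.
      by apply/orP; left; apply/bigcupP; exists k.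
    by rewrite !zE.
  have same_messages : shuffle M S v = shuffle M S v'.
    apply: functional_extensionality_dep => k'.
    by have /ffunP/(_ k') := fE; rewrite !ffunE.
  by rewrite -(decodeP v k i j iW) -(decodeP v' k i j iW) same_view same_messages.
have := leq_card_in _ _ f_inj.
rewrite card_pffun_on card_dep_ffun card_tuple card_bool.
have -> : foldr muln 1%N [seq #|{: (msg_len S k).-tuple bool}| | k : 'I_K]
    = (2 ^ \sum_(k < K) msg_len S k)%N.
  rewrite expn_sum foldrE big_image /=.
  by apply: eq_bigr => k _; rewrite card_tuple card_bool.
by rewrite -expnM leq_exp2l // cardsX mulnC.
Qed.

(** Reduces a scheme to one-bit messages: the first hypothesis says that a sender can compute its
    bit, the second replaces an explicit decoder by injectivity, since any realization consistent
    with what a node sees is correct where it matters. *)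
Lemma scheme_of_bits (K Q N T : nat) (M : 'I_K -> {set 'I_N})
    (W : 'I_K -> {set 'I_Q}) (I : finType) (sender : I -> 'I_K)
    (bit : I -> realization Q N T -> bool) :
  (forall m v v', map_phase (M (sender m)) v = map_phase (M (sender m)) v' ->
     bit m v = bit m v') ->
  (forall v v' k i j, map_phase (M k) v = map_phase (M k) v' ->
     (forall m, bit m v = bit m v') -> i \in W k -> v (i, j) = v' (i, j)) ->
  exists S : shuffle_scheme K Q N T,
    achievable M W S /\ (\sum_(k < K) msg_len S k = #|I|)%N.
Proof.
move=> bit_view bit_inj.
pose len k := #|[pred m | sender m == k]|.
pose v0 : realization Q N T := [ffun=> [tuple of nseq T false]].
pose realize k (V : view Q N T) :=
  odflt v0 [pick v | map_phase (M k) v == V].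
pose enc k (V : view Q N T) : (len k).-tuple bool :=
  [tuple bit (enum_val e) (realize k V) | e < len k].
have realizeK k v : map_phase (M k) (realize k (map_phase (M k) v)) =
    map_phase (M k) v.
  by rewrite /realize; case: pickP => [w /eqP //|/(_ v)]; rewrite eqxx.
exists (ShuffleScheme enc); split; last first.
  rewrite -sum1_card (partition_big sender predT) //=.
  by apply: eq_bigr => k _; rewrite sum1_card.
pose consistent k (ms : messages (ShuffleScheme enc)) (V : view Q N T) :=
  [pred v | (map_phase (M k) v == V)
         && [forall k', shuffle M (ShuffleScheme enc) v k' == ms k']].
exists (fun k ms V => odflt v0 [pick v in consistent k ms V]) => v k i j iW.
case: pickP => [w|/(_ v)]; last first.
  by rewrite !inE eqxx /= => /negbT/forallP []; move=> k'; rewrite eqxx.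
case/andP=> /eqP same_view /forallP same_messages /=.
apply: (bit_inj w v k i j same_view _ iW) => m.
have m_sent : m \in [pred m' | sender m' == sender m] by rewrite inE eqxx.
have /eqP/(congr1 (fun u => tnth u (enum_rank_in m_sent m))) :=
  same_messages (sender m).
rewrite /shuffle /= !tnth_mktuple enum_rankK_in // => bitE.
rewrite -(bit_view m _ _ (realizeK _ w)) bitE.
exact: bit_view (realizeK _ v).
Qed.

(** * Zero-sum splitting of a block *)

(** The first [s - 1] bits together with their parity form the [alpha], and the other [s] bits are
    the [beta]; this is where [2 * s - 1] comes from. The zero sum is stated as what decoding needs:
    any [s - 1] of the [alpha] fix the last. *)
Lemma parity_split (s : nat) : (0 < s)%N ->
  exists alpha beta : 'I_s -> (2 * s - 1).-tuple bool -> bool,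
    (forall i y y', (forall j, j != i -> alpha j y = alpha j y') ->
       alpha i y = alpha i y') /\
    (forall y y', (forall i, alpha i y = alpha i y') ->
       (forall i, beta i y = beta i y') -> y = y').
Proof.
case: s => // n _; have -> : (2 * n.+1 - 1 = n + n.+1)%N by lia.
pose parity (y : (n + n.+1).-tuple bool) :=
  \big[addb/false]_(j < n) tnth y (lshift n.+1 j).
pose alpha (i : 'I_n.+1) (y : (n + n.+1).-tuple bool) :=
  if unlift ord_max i is Some j then tnth y (lshift n.+1 j) else parity y.
exists alpha, (fun i y => tnth y (rshift n i)).
have alpha_lift j y : alpha (lift ord_max j) y = tnth y (lshift n.+1 j).
  by rewrite /alpha liftK.
have alpha_max y : alpha ord_max y =
    \big[addb/false]_(j < n) alpha (lift ord_max j) y.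
  by rewrite {1}/alpha unlift_none; apply: eq_bigr => j _; rewrite alpha_lift.
split=> [i y y' eq_alpha | y y' eq_alpha eq_beta].
  move: eq_alpha; have [j ->|->] := unliftP ord_max i => eq_alpha.
    (* In the two equal parities all summands but the [j]-th agree, so the [j]-th ones agree by
       cancellation. *)
    have := eq_alpha ord_max; rewrite neq_lift => /(_ isT).
    rewrite !alpha_max (bigD1 j) //= [RHS](bigD1 j) //=.
    rewrite (eq_bigr (fun l => alpha (lift ord_max l) y')) => [|l lj].
      by move/addIb.
    by apply: eq_alpha; rewrite (inj_eq lift_inj).
  rewrite !alpha_max; apply: eq_bigr => j _.
  by apply: eq_alpha; rewrite eq_sym neq_lift.
apply: eq_from_tnth => e; have [j|j] := split_ordP e => ->; last exact: eq_beta.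
by rewrite -!alpha_lift.
Qed.

(** * Partitions and coordinates of transversals *)

(** Numbering the elements of each block lets the coded scheme run separately for each pair of
    positions in a function block and a file block. *)
Lemma partition_family_labels (I T : finType) (P : I -> {set T}) (e : nat) :
  is_partition_family P -> (forall i, #|P i| = e) ->
  exists mk : I -> 'I_e -> T,
    (forall i w, mk i w \in P i) /\ (forall t, exists i w, t = mk i w).
Proof.
move=> [_ cover] cardP.
exists (fun i w => enum_val (cast_ord (esym (cardP i)) w)).
split=> [i w|t]; first exact: enum_valP.
have /bigcupP[i _ ti] : t \in \bigcup_i P i by rewrite cover inE.
exists i, (cast_ord (cardP i) (enum_rank_in ti t)).
by rewrite cast_ordK enum_rankK_in.
Qed.

Lemma partition_family_uniq (I T : finType) (P : I -> {set T}) i j t :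
  is_partition_family P -> t \in P i -> t \in P j -> i = j.
Proof.
by move=> [disj _] ti tj; apply: contraTeq ti => /disj /disjointFl ->.
Qed.

Lemma mem_bigcup_partition (I T : finType) (P : I -> {set T}) (A : pred I) i t :
  is_partition_family P -> t \in P i -> (t \in \bigcup_(j | A j) P j) = A i.
Proof.
move=> partP ti; apply/bigcupP/idP => [[j Aj tj]|Ai]; last by exists i.
by rewrite (partition_family_uniq partP ti tj).
Qed.

Lemma card_bigcup_partition (I T : finType) (P : I -> {set T}) (A : pred I) e :
  is_partition_family P -> (forall i, #|P i| = e) ->
  #|\bigcup_(i | A i) P i| = (#|A| * e)%N.
Proof.
move=> [disj _] cardP; rewrite big_mkcond -sum1_card /=.
rewrite partition_disjoint_bigcup => [|i j /disj dij]; last first.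
  by do 2!case: ifP => _; rewrite // -setI_eq0 ?finset.set0I ?finset.setI0.
rewrite -sum_nat_const [RHS]big_mkcond; apply: eq_bigr => i _.
by rewrite sum1_card unfold_in; case: ifP => _; rewrite ?cardP ?cards0.
Qed.

(** A transversal is the same as a choice of one node per class: [t l i] is the unique node of
    [Tr l] in [Kp i]. *)
Lemma transversal_coordinates (s K X : nat) (Kp : 'I_s -> {set 'I_K})
    (Tr : 'I_X -> {set 'I_K}) :
  is_partition_family Kp -> injective Tr ->
  (forall U : {set 'I_K},
    (exists l : 'I_X, Tr l = U) <-> (forall i : 'I_s, #|U :&: Kp i| = 1%N)) ->
  exists t : 'I_X -> {ffun 'I_s -> 'I_K},
    [/\ injective t,
        forall g : {ffun 'I_s -> 'I_K},
          (exists l, t l = g) <-> (forall i, g i \in Kp i)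
      & forall l k, (k \in Tr l) = [exists i, t l i == k]].
Proof.
move=> partK Tr_inj TrP.
have Tr1 l i : {k | Tr l :&: Kp i = [set k]}.
  have /(_ i)/eqP/cards1P : forall i, #|Tr l :&: Kp i| = 1%N.
    by apply/TrP; exists l.
  by move=> kP; apply: cid.
pose t l : {ffun 'I_s -> 'I_K} := [ffun i => sval (Tr1 l i)].
have tE l i : Tr l :&: Kp i = [set t l i] by rewrite ffunE; case: (Tr1 l i).
have tTr l i : (t l i \in Tr l) * (t l i \in Kp i).
  by have := set11 (t l i); rewrite -tE inE => /andP[-> ->].
have TrE l k : (k \in Tr l) = [exists i, t l i == k].
  apply/idP/existsP => [kl|[i /eqP <-]]; last by rewrite tTr.
  have /bigcupP[i _ ki] : k \in \bigcup_i Kp i by rewrite partK.2 inE.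
  by exists i; rewrite eq_sym -finset.in_set1 -tE inE kl.
exists t; split=> // [l l' tl|g].
  by apply: Tr_inj; apply/setP => k; rewrite !TrE tl.
split=> [[l <-] i|gK]; first by rewrite tTr.
(* The image of a choice function is a transversal, hence is enumerated by [Tr]. *)
have /TrP[l lE] : forall i, #|[set g j | j in 'I_s] :&: Kp i| = 1%N.
  move=> i; apply/eqP/cards1P; exists (g i); apply/setP => k; rewrite !inE.
  apply/andP/eqP => [[/imsetP[j _ ->] gji]|->]; last by rewrite imset_f.
  by rewrite (partition_family_uniq partK gji (gK j)).
exists l; apply/ffunP => i; apply/eqP.
by rewrite eq_sym -finset.in_set1 -tE lE inE imset_f ?gK.
Qed.

(** * The coded shuffle and its decoding *)

(** For each label pair, a meeting pair costs [2 * s - 1] bits and serves both of its orders, hence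
    the condition [p.1 < p.2]; each ordered disjoint pair costs [s] bits. *)
Lemma coded_shuffle (s K X Q N eta1 eta2 : nat) (Kp : 'I_s -> {set 'I_K})
    (t : 'I_X -> {ffun 'I_s -> 'I_K}) (M : 'I_K -> {set 'I_N})
    (W : 'I_K -> {set 'I_Q}) (mkN : 'I_X -> 'I_eta1 -> 'I_N)
    (mkQ : 'I_X -> 'I_eta2 -> 'I_Q) :
  (0 < s)%N -> injective t ->
  (forall g : {ffun 'I_s -> 'I_K},
     (exists l, t l = g) <-> (forall i, g i \in Kp i)) ->
  (forall k l w, (mkN l w \in M k) = [exists i, t l i == k]) ->
  (forall n, exists l w, n = mkN l w) ->
  (forall k l u, (mkQ l u \in W k) = [exists i, t l i == k]) ->
  (forall q, exists l u, q = mkQ l u) ->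
  exists S : shuffle_scheme K Q N (2 * s - 1),
    achievable M W S /\
    (\sum_(k < K) msg_len S k = eta1 * eta2 *
      ((2 * s - 1) *
         #|[pred p : 'I_X * 'I_X | (p.1 < p.2) && [exists i, t p.1 i == t p.2 i]]|
       + s * #|[pred p : 'I_X * 'I_X | [forall i, t p.1 i != t p.2 i]]|))%N.
Proof.
move=> s_gt0 t_inj tP mkNM mkN_onto mkQW mkQ_onto.
have [alpha [beta [alpha_parity split_inj]]] := parity_split s_gt0.
have tK l i : t l i \in Kp i by move: i; apply/tP; exists l.
have sw_ex i a b : {l | t l = [ffun j => if j == i then t b i else t a j]}.
  by apply/cid/tP => j; rewrite ffunE; case: eqP => [->|_]; apply: tK.
(* [sw i a b] is [a] with its [i]-th node taken from [b]. The partner of [(a, b)] at [i] is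
   [(sw i b a, sw i a b)], and by [swK] taking partners is an involution. *)
pose sw i a b := sval (sw_ex i a b).
have swE i a b j : t (sw i a b) j = if j == i then t b i else t a j.
  by rewrite /sw; case: (sw_ex i a b) => l /= ->; rewrite ffunE.
have swK i a b : sw i (sw i a b) (sw i b a) = a.
  apply: t_inj; apply/ffunP => j; rewrite !swE eqxx.
  by case: eqP => // ->.
pose meet :=
  [pred p : 'I_X * 'I_X | (p.1 < p.2)%N && [exists i, t p.1 i == t p.2 i]].
pose disj := [pred p : 'I_X * 'I_X | [forall i, t p.1 i != t p.2 i]].
have disj_sw i a b : disj (a, b) -> disj (sw i b a, sw i a b).
  move=> /forallP /= ab; apply/forallP => j /=; rewrite !swE.
  by have [_|_] := eqVneq j i; rewrite ?ab // eq_sym ab.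
have meet_common (p : {p | meet p}) : {i | t (val p).1 i = t (val p).2 i}.
  by apply: cid; case: p => p /= /andP[_ /existsP[i /eqP]]; exists i.
pose lab := ('I_eta2 * 'I_eta1)%type.
pose V (v : realization Q N (2 * s - 1)) a b (c : lab) : (2 * s - 1).-tuple bool :=
  v (mkQ a c.1, mkN b c.2).
pose I : finType :=
  (({p | meet p} * 'I_(2 * s - 1) + {p | disj p} * 'I_s) * lab)%type.
pose sender (m : I) : 'I_K :=
  match m.1 with
  | inl (p, e) => t (val p).2 (sval (meet_common p))
  | inr (p, i) => t (val p).2 i
  end.
pose bit (m : I) v : bool :=
  match m.1 with
  | inl (p, e) => tnth (V v (val p).1 (val p).2 m.2) e
                    (+) tnth (V v (val p).2 (val p).1 m.2) e
  | inr (p, i) => let: (a, b) := val p in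
                  alpha i (V v a b m.2) (+) beta i (V v (sw i b a) (sw i a b) m.2)
  end.
have V_known k v v' a b c i : map_phase (M k) v = map_phase (M k) v' ->
    t b i = k -> V v a b c = V v' a b c.
  move=> /ffunP/(_ (mkQ a c.1, mkN b c.2)) + bk; rewrite !ffunE /= mkNM.
  by case: existsP => [_ [] //|[]]; exists i; apply/eqP.
have [||S [S_ach S_len]] := @scheme_of_bits K Q N (2 * s - 1) M W I sender bit.
- move=> [[[p e]|[[[a b] ab] i]] c] v v' view_eq; rewrite /bit /=.
    rewrite (V_known _ _ _ _ _ _ (sval (meet_common p)) view_eq) //.
    by rewrite (V_known _ _ _ _ _ _ (sval (meet_common p)) view_eq) //
      (svalP (meet_common p)).
  rewrite (V_known _ _ _ _ _ _ i view_eq) //.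
  rewrite (V_known _ _ _ _ _ _ i view_eq) //.
  by rewrite swE eqxx.
- move=> v v' k q n view_eq bit_eq qW.
  have [a [u qE]] := mkQ_onto q; have [b [w nE]] := mkN_onto n.
  rewrite {}qE {}nE mkQW in qW *.
  have {qW}[i /eqP ai] := existsP qW.
  suff : V v a b (u, w) = V v' a b (u, w) by [].
  move: (u, w) => c {u w}.
  have known := V_known _ _ _ _ _ c _ view_eq.
  have [ab|] := boolP (disj (a, b)); last first.
    (* If [a] and [b] meet, the node [k] of [a] knows [V_ba] and cancels it from the sum; if [a = b]
       it already knows the value. *)
    rewrite negb_forall => /existsP[j]; rewrite negbK => /= abj.
    have ba := known b a i ai.
    have [lt_ab|lt_ba|/val_inj eq_ab] := ltngtP a b; last first.
    + by rewrite eq_ab in ba *.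
    + have pP : meet (b, a).
        by rewrite /= lt_ba; apply/existsP; exists j; rewrite eq_sym.
      apply: eq_from_tnth => e.
      have := bit_eq (inl (exist (fun p => meet p) _ pP, e), c).
      by rewrite /bit /= ba => /addbI.
    + have pP : meet (a, b).
        by rewrite /= lt_ab; apply/existsP; exists j.
      apply: eq_from_tnth => e.
      have := bit_eq (inl (exist (fun p => meet p) _ pP, e), c).
      by rewrite /bit /= ba => /addIb.
  have bits a' b' (ab' : disj (a', b')) j :=
    bit_eq (inr (exist (fun p => disj p) _ ab', j), c).
  (* For [j != i], [sw j a' b'] still contains [k] at [i], so [k] knows the masking block. *)
  have alpha_ne a' b' : disj (a', b') -> t a' i = k -> forall j, j != i ->
      alpha j (V v a' b' c) = alpha j (V v' a' b' c).
    move=> ab' a'i j ji; have := bits _ _ ab' j; rewrite /bit /=.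
    rewrite (known _ (sw j a' b') i) => [/addIb //|].
    by rewrite swE eq_sym (negbTE ji).
  (* Stated for all disjoint pairs wanted by [k], because it is also applied to the partner of
     [(a, b)] at [i]. *)
  have alpha_eq a' b' : disj (a', b') -> t a' i = k -> forall j,
      alpha j (V v a' b' c) = alpha j (V v' a' b' c).
    move=> ab' a'i j; have [->|] := eqVneq j i; last exact: alpha_ne.
    by apply: alpha_parity => l; apply: alpha_ne.
  apply: split_inj => j; first exact: alpha_eq.
  (* The partner's message carries [beta j] of [V_ab]. Its [alpha] term is removed by [alpha_eq]
     when [j = i], and by direct knowledge of the block otherwise. *)
  have := bits _ _ (disj_sw j _ _ ab) j; rewrite /bit /= !swK.
  have [->|ji] := eqVneq j i.
    rewrite alpha_eq => [/addbI //||]; first exact: disj_sw.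
    by rewrite swE eqxx.
  rewrite (known _ (sw j a b) i) => [/addbI //|].
  by rewrite swE eq_sym (negbTE ji).
exists S; split=> //.
rewrite S_len !card_prod card_sum !card_prod !card_ord !card_sig.
by rewrite mulnC (mulnC eta2); congr (_ * (_ + _))%N; rewrite mulnC.
Qed.

(** * Counting pairs of transversals *)

Lemma card_transversals (s K X : nat) (Kp : 'I_s -> {set 'I_K})
    (t : 'I_X -> {ffun 'I_s -> 'I_K}) (F : 'I_s -> {set 'I_K}) :
  injective t ->
  (forall g : {ffun 'I_s -> 'I_K},
     (exists l, t l = g) <-> (forall i, g i \in Kp i)) ->
  (forall i, F i \subset Kp i) ->
  #|[pred l | [forall i, t l i \in F i]]| = (\prod_(i < s) #|F i|)%N.
Proof.
move=> t_inj tP FK; rewrite -(card_imset _ t_inj).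
transitivity #|family F|; last by rewrite card_family foldrE big_image.
apply: eq_card => g; apply/imsetP/familyP => [[l /forallP lF ->] //|gF].
have [l lg] : exists l, t l = g.
  by apply/tP => i; apply: (fintype.subsetP (FK i)) (gF i).
by exists l; rewrite // !inE lg; apply/forallP.
Qed.

(** Once the first transversal is fixed, the second has [x i - 1] choices at each coordinate in [A]
    and one elsewhere. *)
Lemma card_transversal_pairs (s K X : nat) (x : 'I_s -> nat)
    (Kp : 'I_s -> {set 'I_K}) (t : 'I_X -> {ffun 'I_s -> 'I_K}) (A : {set 'I_s}) :
  (forall i, #|Kp i| = x i) -> injective t ->
  (forall g : {ffun 'I_s -> 'I_K},
     (exists l, t l = g) <-> (forall i, g i \in Kp i)) ->
  #|[pred p : 'I_X * 'I_X | [set i | t p.1 i != t p.2 i] == A]|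
    = (X * \prod_(i in A) (x i - 1))%N.
Proof.
move=> cardK t_inj tP.
rewrite -sum1_card (partition_big fst predT) //= -[X in (X * _)%N]card_ord.
rewrite -sum_nat_const; apply: eq_bigr => a _.
have tK l i : t l i \in Kp i by move: i; apply/tP; exists l.
pose F i := if i \in A then Kp i :\ t a i else [set t a i].
rewrite (reindex (pair a)) /=; last first.
  by exists snd => [b _ //|[a' b] /andP[_ /eqP /= ->]].
rewrite sum1_card.
transitivity #|[pred l | [forall i, t l i \in F i]]|.
  apply: eq_card => b; rewrite unfold_in !inE /= eqxx andbT.
  apply/eqP/forallP => [abA i|bF]; last apply/setP => i; last have := bF i.
    rewrite /F -abA inE; have [->|ab] := eqVneq (t a i) (t b i);
      by rewrite !inE ?eqxx // tK eq_sym ab.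
  rewrite inE /F; case: ifP => _; rewrite !inE; last by move/eqP->; rewrite eqxx.
  by case/andP; rewrite eq_sym.
rewrite (card_transversals t_inj tP) => [|i]; last first.
  by rewrite /F; case: ifP => _; rewrite ?finset.subD1set // finset.sub1set tK.
rewrite [RHS]big_mkcond /=; apply: eq_bigr => i _.
rewrite /F; case: ifP => _; last by rewrite cards1.
by rewrite -(cardK i) (cardsD1 (t a i) (Kp i)) tK add1n subn1.
Qed.

(** The set of differing coordinates is nonempty for distinct transversals and proper for meeting
    ones. The factor 2 passes from ordered to unordered pairs. *)
Lemma card_meeting_pairs (s K X : nat) (x : 'I_s -> nat)
    (Kp : 'I_s -> {set 'I_K}) (t : 'I_X -> {ffun 'I_s -> 'I_K}) :
  (forall i, #|Kp i| = x i) -> injective t ->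
  (forall g : {ffun 'I_s -> 'I_K},
     (exists l, t l = g) <-> (forall i, g i \in Kp i)) ->
  (2 * #|[pred p : 'I_X * 'I_X | (p.1 < p.2) && [exists i, t p.1 i == t p.2 i]]|
    = X * \sum_(A : {set 'I_s} | 0 < #|A| < s) \prod_(i in A) (x i - 1))%N.
Proof.
move=> cardK t_inj tP.
pose diff (p : 'I_X * 'I_X) := [set i | t p.1 i != t p.2 i].
have diff0 p : (0 < #|diff p|)%N = (p.1 != p.2).
  rewrite card_gt0; congr (~~ _); apply/eqP/eqP => [dp|pp]; last first.
    by apply/setP => i; rewrite !inE pp eqxx.
  apply/t_inj/ffunP => i; apply/eqP; have /setP/(_ i) := dp.
  by rewrite !inE => /negbFE.
have diffT p : (#|diff p| < s)%N = [exists i, t p.1 i == t p.2 i].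
  apply/idP/existsP => [|[i pi]].
    apply: contraTP => /forallNP np; suff -> : diff p = [set: 'I_s].
      by rewrite cardsT card_ord ltnn.
    by apply/setP => i; rewrite !inE; apply/negP/np.
  rewrite -[s in (_ < s)%N]card_ord -cardsT; apply/proper_card/properP.
  by split=> //; exists i; rewrite !inE // negbK.
transitivity #|[pred p | (0 < #|diff p| < s)%N]|.
  rewrite mul2n -addnn -!sum1_card.
  rewrite [RHS](bigID (fun p : 'I_X * 'I_X => (p.1 < p.2)%N)) /=.
  congr (_ + _)%N.
    apply: eq_bigl => p; rewrite !inE diff0 diffT -val_eqE /=.
    by have [lt_p|_] := ltnP p.1 p.2; rewrite ?andbF //= andbT neq_ltn lt_p.
  (* Swapping the components matches the pairs with [p.1 > p.2] to those with [p.1 < p.2]. *)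
  rewrite (reindex_inj (h := fun p => (p.2, p.1))) => [|[a b] [a' b'] [-> ->] //].
  apply: eq_bigl => p; rewrite !inE /= diff0 diffT -val_eqE /= -leqNgt ltn_neqAle.
  under eq_existsb do rewrite eq_sym.
  by rewrite eq_sym andbAC.
rewrite big_distrr /= -sum1_card.
rewrite (partition_big diff (fun A => (0 < #|A| < s)%N)) //=.
apply: eq_bigr => A A_size; rewrite -(card_transversal_pairs A cardK t_inj tP).
rewrite -sum1_card; apply: eq_bigl => p; rewrite !inE /=.
by apply: andb_idl => /eqP ->.
Qed.

(** * Natural-number forms of [Lc] and of the product of the class sizes *)

Lemma Lc_natE (R : realType) (s : nat) (x : 'I_s -> nat) :
  (0 < s)%N -> (forall i, 0 < x i)%N ->
  Lc R x =
    (\sum_(A : {set 'I_s} | (0 < #|A| < s)%N) \prod_(i in A) (x i - 1))%N%:R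
      / (2 * (\prod_(i < s) x i)%N%:R)
    + s%:R / ((\prod_(i < s) x i)%N%:R * (2 * s%:R - 1))
        * (\prod_(i < s) (x i - 1))%N%:R.
Proof.
move=> s_gt0 x_gt0; rewrite /Lc.
have prodE (A : {set 'I_s}) :
    \prod_(i in A) ((x i)%:R - 1) = (\prod_(i in A) (x i - 1))%N%:R :> R.
  by rewrite natr_prod; apply: eq_bigr => i _; rewrite natrB.
congr (_ + _ * _); last first.
  by rewrite natr_prod; apply: eq_bigr => i _; rewrite natrB.
rewrite mulrC mul1r; congr (_ / _).
rewrite natr_sum [RHS]big_mkcond /=.
under eq_bigr do rewrite big_mkcond.
rewrite exchange_big /=; apply: eq_bigr => A _; rewrite -prodE -big_mkcond /=.
by under eq_bigl do rewrite eq_sym; rewrite big_nat1_eq.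
Qed.

(** Expands the product of [(x i - 1) + 1] over subsets; the empty and the full set, distinct since
    [0 < s], give the outer terms. *)
Lemma prod_subset_sum (s : nat) (x : 'I_s -> nat) :
  (0 < s)%N -> (forall i, 0 < x i)%N ->
  (\prod_(i < s) x i = 1
     + \sum_(A : {set 'I_s} | 0 < #|A| < s) \prod_(i in A) (x i - 1)
     + \prod_(i < s) (x i - 1))%N.
Proof.
move=> s_gt0 x_gt0.
rewrite -(eq_bigr _ (fun i _ => subnK (x_gt0 i))) bigA_distr /=.
under eq_bigr do rewrite -big_mkcond.
rewrite (bigD1 finset.set0) //= big_set0 -addnA; congr (_ + _)%N.
rewrite (bigD1 [set: 'I_s]) /=; last first.
  by rewrite -card_gt0 cardsT card_ord.
rewrite addnC; congr (_ + _)%N; last by apply: eq_bigl => i; rewrite inE.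
apply: eq_bigl => A; rewrite card_gt0; congr (_ && _).
by rewrite -properT properEcard finset.subsetT cardsT card_ord.
Qed.

(** * Lower bound on the load *)

(** The ratio of [n * n] to the product of the halves is at most 9/2, reached at [n = 3]; the weaker
    6 is enough, as 4 times 1/6 is the bound 2/3 on [Lc]. *)
Lemma six_mul_half (n : nat) : (2 <= n)%N -> (n * n <= 6 * (n./2 * (n - n./2)))%N.
Proof. by move=> n_ge2; have := odd_double_half n; case: (odd n) => /=; nia. Qed.

(** A transversal has one node in the class [i0], so [m] nodes of that class want a fraction
    [m / x i0] of the functions and miss a fraction [(x i0 - m) / x i0] of the files. The half [m]
    makes the product of these fractions at least 1/6. *)
Lemma load_lower_bound (s : nat) (x : 'I_s -> nat) (eta1 eta2 X K N Q T : nat)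
    (Kp : 'I_s -> {set 'I_K}) (Tr : 'I_X -> {set 'I_K})
    (B : 'I_X -> {set 'I_N}) (D : 'I_X -> {set 'I_Q})
    (M : 'I_K -> {set 'I_N}) (W : 'I_K -> {set 'I_Q})
    (S : shuffle_scheme K Q N T) (i0 : 'I_s) :
  (2 <= x i0)%N -> X = (\prod_(i < s) x i)%N ->
  N = (eta1 * X)%N -> Q = (eta2 * X)%N ->
  combinatorial_assignment x eta1 eta2 Kp Tr B D M W ->
  achievable M W S ->
  (Q * N * T <= 6 * \sum_(k < K) msg_len S k)%N.
Proof.
move=> xi0 XE NE QE hA S_ach.
have [t [t_inj tP TrE]] :=
  transversal_coordinates (ca_nodes hA) (ca_trans_inj hA) (ca_trans hA).
have tK l i : t l i \in Kp i by move: i; apply/tP; exists l.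
set m := (x i0)./2; pose P := [set:: take m (enum (Kp i0))].
have PK : P \subset Kp i0.
  by apply/fintype.subsetP => k; rewrite inE => /mem_take; rewrite mem_enum.
have cardP : #|P| = m.
  rewrite cardsE (card_uniqP _) ?take_uniq ?enum_uniq // size_takel //.
  by rewrite -cardE (ca_nodes_card hA) /m; lia.
pose Y := (\prod_(i < s | i != i0) x i)%N.
have XY : X = (x i0 * Y)%N by rewrite XE (bigD1 i0).
have TrP k l : k \in P -> (k \in Tr l) = (t l i0 == k).
  move=> kP; rewrite TrE; apply/existsP/idP => [[i /eqP ik]|]; last by exists i0.
  rewrite -(partition_family_uniq (ca_nodes hA) (tK l i) (j := i0)) ?ik //.
  exact: (fintype.subsetP PK).
have cover_card (T' : finType) (C : 'I_X -> {set T'}) e :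
    is_partition_family C -> (forall l, #|C l| = e) ->
    #|\bigcup_(k in P) \bigcup_(l | k \in Tr l) C l| = (m * Y * e)%N.
  move=> partC cardC.
  have -> : \bigcup_(k in P) \bigcup_(l | k \in Tr l) C l =
      \bigcup_(l | t l i0 \in P) C l.
    apply/setP => c; apply/bigcupP/bigcupP => [[k kP]|[l lP cl]].
      case/bigcupP => l; rewrite TrP // => /eqP lk cl.
      by exists l; rewrite // lk.
    by exists (t l i0) => //; apply/bigcupP; exists l; rewrite // TrP.
  rewrite (card_bigcup_partition _ partC cardC); congr (_ * _)%N.
  (* The blocks covered by [P] are those whose transversal has its [i0]-th coordinate in [P], the
     others being free. *)
  pose F i := if i == i0 then P else Kp i.
  transitivity #|[pred l | [forall i, t l i \in F i]]|.
    apply: eq_card => l; rewrite unfold_in; apply/idP/forallP => [lP i|/(_ i0)].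
      by rewrite /F; case: eqP => [->|].
    by rewrite /F eqxx.
  rewrite (card_transversals t_inj tP) => [|i]; last first.
    by rewrite /F; case: eqP => [->|].
  rewrite (bigD1 i0) //= /F eqxx cardP; congr (_ * _)%N.
  by apply: eq_bigr => i /negPf ->; rewrite (ca_nodes_card hA).
have := cut_set_bound P S_ach; rewrite [#|~: _|]cardsCs finset.setCK card_ord.
under eq_bigr do rewrite (ca_W hA).
under [in X in (_ * (_ - X))%N]eq_bigr do rewrite (ca_M hA).
rewrite (cover_card _ _ _ (ca_files hA) (ca_files_card hA)).
rewrite (cover_card _ _ _ (ca_funs hA) (ca_funs_card hA)).
move: (\sum_(k < K) msg_len S k)%N => len; rewrite NE QE XY.
have := six_mul_half xi0; rewrite -/m.
have -> : (eta1 * (x i0 * Y) - m * Y * eta1 = eta1 * Y * (x i0 - m))%N.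
  by rewrite mulnBr -!mulnA; congr (_ - _)%N; lia.
move=> half le_len.
apply: leq_trans (leq_mul (leqnn 6) le_len).
have -> : (6 * (m * Y * eta2 * (eta1 * Y * (x i0 - m)) * T) =
  6 * (m * (x i0 - m)) * (eta1 * eta2 * Y * Y * T))%N by ring.
have -> : (eta2 * (x i0 * Y) * (eta1 * (x i0 * Y)) * T =
  x i0 * x i0 * (eta1 * eta2 * Y * Y * T))%N by ring.
exact: leq_mul.
Qed.

(** * Bounding and attaining [Lc], and the comparison with the optimum *)

(** With the class-size product written as [1 + g + f], [Lc] weights [g] by 1/2 and [f] by
    [r / (2 * r - 1)]. The latter decreases in [r] and equals 2/3 at [r = 2]. *)
Lemma Lc_le (R : realType) (s : nat) (x : 'I_s -> nat) :
  (2 <= s)%N -> (forall i, 0 < x i)%N -> Lc R x <= 2 / 3.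
Proof.
move=> s_ge2 x_gt0; have s_gt0 := ltnW s_ge2.
rewrite (Lc_natE R s_gt0 x_gt0) (prod_subset_sum s_gt0 x_gt0).
set G := (\sum_(A | _) _)%N; set F := (\prod_(i < s) _)%N.
have sR : 2 <= s%:R :> R by rewrite ler_nat.
rewrite -addnA natrD natrD.
have : 0 <= G%:R :> R by [].
have : 0 <= F%:R :> R by [].
move: (s%:R : R) (G%:R : R) (F%:R : R) sR => r g f r_ge2 f_ge0 g_ge0.
set y := 1 + (g + f); have y_gt0 : 0 < y by rewrite /y; lra.
have r_gt0 : 0 < 2 * r - 1 by lra.
have -> : g / (2 * y) + r / (y * (2 * r - 1)) * f =
    (g / 2 + r / (2 * r - 1) * f) / y by field; rewrite !gt_eqF.
rewrite ler_pdivrMr //.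
have : r / (2 * r - 1) <= 2 / 3 by rewrite ler_pdivrMr //; lra.
by move=> /(ler_wpM2r f_ge0); rewrite /y; lra.
Qed.

Lemma exists_scheme_Lc (R : realType) (s : nat) (x : 'I_s -> nat)
    (eta1 eta2 X K N Q : nat) (Kp : 'I_s -> {set 'I_K}) (Tr : 'I_X -> {set 'I_K})
    (B : 'I_X -> {set 'I_N}) (D : 'I_X -> {set 'I_Q})
    (M : 'I_K -> {set 'I_N}) (W : 'I_K -> {set 'I_Q}) :
  (0 < s)%N -> (forall i, 0 < x i)%N -> (0 < eta1)%N -> (0 < eta2)%N ->
  X = (\prod_(i < s) x i)%N -> N = (eta1 * X)%N -> Q = (eta2 * X)%N ->
  combinatorial_assignment x eta1 eta2 Kp Tr B D M W ->
  exists S : shuffle_scheme K Q N (2 * s - 1),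
    achievable M W S /\ load R S = Lc R x.
Proof.
move=> s_gt0 x_gt0 eta1_gt0 eta2_gt0 XE NE QE hA.
have [t [t_inj tP TrE]] :=
  transversal_coordinates (ca_nodes hA) (ca_trans_inj hA) (ca_trans hA).
have [mkN [mkNB mkN_onto]] :=
  partition_family_labels (ca_files hA) (ca_files_card hA).
have [mkQ [mkQD mkQ_onto]] :=
  partition_family_labels (ca_funs hA) (ca_funs_card hA).
have [k l w|k l u|S [S_ach S_len]] :=
  coded_shuffle s_gt0 t_inj tP (M := M) (W := W) _ mkN_onto _ mkQ_onto.
- by rewrite (ca_M hA) (mem_bigcup_partition _ (ca_files hA) (mkNB l w)) TrE.
- by rewrite (ca_W hA) (mem_bigcup_partition _ (ca_funs hA) (mkQD l u)) TrE.
exists S; split=> //; rewrite /load S_len.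
have meetE := card_meeting_pairs (ca_nodes_card hA) t_inj tP.
(* Disjoint pairs are those that differ in every coordinate. *)
have disjE : #|[pred p : 'I_X * 'I_X | [forall i, t p.1 i != t p.2 i]]| =
    (X * \prod_(i < s) (x i - 1))%N.
  transitivity #|[pred p : 'I_X * 'I_X |
      [set i | t p.1 i != t p.2 i] == [set: 'I_s]]|.
    apply: eq_card => p; rewrite !inE; apply/forallP/eqP => [ne|/setP eqT i].
      by apply/setP => i; rewrite !inE ne.
    by have := eqT i; rewrite !inE.
  rewrite (card_transversal_pairs _ (ca_nodes_card hA) t_inj tP).
  by congr (_ * _)%N; apply: eq_bigl => i; rewrite inE.
rewrite (Lc_natE R s_gt0 x_gt0) -XE disjE.
have X_gt0 : (0 < X)%N by rewrite XE prodn_gt0.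
move: meetE; set P := #|_|; set G := (\sum_(A | _) _)%N.
set F := (\prod_(i < s) _)%N => meetE; rewrite NE QE.
have PE : P%:R = X%:R * G%:R / 2 :> R.
  by rewrite -natrM -meetE natrM mulrC mulKf ?pnatr_eq0.
rewrite !(natrM, natrD) natrB ?muln_gt0 // natrM PE.
have : 0 < X%:R :> R by rewrite ltr0n.
have : 0 < eta1%:R :> R by rewrite ltr0n.
have : 0 < eta2%:R :> R by rewrite ltr0n.
have : 1 <= s%:R :> R by rewrite ler1n.
move: (X%:R : R) (eta1%:R : R) (eta2%:R : R) (s%:R : R) => y e1 e2 r r1 e2p e1p yp.
have r_gt0 : 0 < 2 * r - 1 by lra.
by field; rewrite !gt_eqF.
Qed.

Theorem theorem2 (R : realType) (s : nat) (x : 'I_s -> nat) (eta1 eta2 : nat)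
    (hs : (2 <= s)%N) (hx : forall i : 'I_s, (2 <= x i)%N)
    (heta1 : (0 < eta1)%N) (heta2 : (0 < eta2)%N)
    (X K N Q : nat)
    (hX : X = (\prod_(i < s) x i)%N) (hK : K = (\sum_(i < s) x i)%N)
    (hN : N = (eta1 * X)%N) (hQ : Q = (eta2 * X)%N)
    (Kp : 'I_s -> {set 'I_K}) (Tr : 'I_X -> {set 'I_K})
    (B : 'I_X -> {set 'I_N}) (D : 'I_X -> {set 'I_Q})
    (M : 'I_K -> {set 'I_N}) (W : 'I_K -> {set 'I_Q})
    (hA : combinatorial_assignment x eta1 eta2 Kp Tr B D M W) :
  1 <= Lc R x / optimal_load R M W <= 4.
Proof.
have s_gt0 := ltnW hs.
have x_gt0 i : (0 < x i)%N := ltnW (hx i).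
have X_gt0 : (0 < X)%N by rewrite hX prodn_gt0.
set L := [set L : R | exists T : nat, (0 < T)%N /\
  exists S : shuffle_scheme K Q N T, achievable M W S /\ L = load R S]%classic.
have LLc : L (Lc R x).
  have [S [S_ach S_load]] :=
    exists_scheme_Lc R s_gt0 x_gt0 heta1 heta2 hX hN hQ hA.
  by exists (2 * s - 1)%N; split; [lia | exists S].
have L_ge : lbound L (1 / 6).
  move=> _ [T [T_gt0 [S [S_ach ->]]]].
  have := load_lower_bound (hx (Ordinal s_gt0)) hX hN hQ hA S_ach.
  rewrite -(ler_nat R) natrM /load => le_len.
  rewrite ler_pdivlMr; first by lra.
  by rewrite ltr0n !muln_gt0 T_gt0 hN hQ !muln_gt0 heta1 heta2 X_gt0.
(* The infimum is controlled because the set is nonempty, containing [Lc R x], and bounded below by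
   [1 / 6]. *)
have opt_ge : 1 / 6 <= optimal_load R M W.
  by apply: lb_le_inf => //; exists (Lc R x).
have opt_le : optimal_load R M W <= Lc R x by apply: ge_inf => //; exists (1 / 6).
have opt_gt0 : 0 < optimal_load R M W by apply: lt_le_trans opt_ge; lra.
have Lc_23 := Lc_le R hs x_gt0.
by rewrite ler_pdivlMr // ler_pdivrMr //; apply/andP; split; lra.
Qed.
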